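(* Let $H = (V, A, B)$ be an $n$-uniform cross-intersecting family. Then $\chi(H) \leq 3$, or $n = 2$ and $H = K_4$ (the complete graph on four vertices).
   Context: A hypergraph is a pair $(V,E)$ where $V$ is a set of vertices and $E$ is a set of subsets of $V$ (edges); it is $n$-uniform if every edge has exactly $n$ vertices. A cross-intersecting family $H = (V, A, B)$ is a hypergraph with vertex set $V$ and edge set $E = A \cup B$ such that every $a \in A$ intersects every $b \in B$, and $A$, $B$ are not empty. A coloring of the vertices is proper if there are no monochromatic edges; the chromatic number $\chi(H)$ is the minimal number of colors that admits a proper coloring.
   Formalization: Edges are assumed to have n ≥ 2 vertices (for n = 1 the single one-vertex edge admits no proper coloring), and H = K_4 is read after deleting isolated vertices, since K_4 plus isolated vertices is also a cross-intersecting family of chromatic number 4. *)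

(* Defs.v *)
From mathcomp Require Import all_boot.
From mathcomp Require Import boolp classical_sets functions cardinality.

Set Implicit Arguments.
Unset Strict Implicit.
Unset Printing Implicit Defensive.

Local Open Scope classical_set_scope.
Local Open Scope card_scope.

(* A hypergraph on the vertex set V (an arbitrary type, possibly infinite) is
   identified with its set of edges. *)
Definition hypergraph (V : Type) := set (set V).

Definition uniform (V : Type) (n : nat) (E : hypergraph V) : Prop :=
  forall e, E e -> e #= `I_n.

(* The family (V, A, B); its underlying hypergraph is A `|` B. *)
Definition cross_intersecting_family (V : Type) (A B : hypergraph V) : Prop :=
  [/\ A !=set0, B !=set0 &
      forall a b, A a -> B b -> a `&` b !=set0].

Definition monochromatic (V : Type) (k : nat) (c : V -> 'I_k) (e : set V) : Prop :=
  exists i : 'I_k, forall x, e x -> c x = i.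

Definition proper_coloring (V : Type) (k : nat) (E : hypergraph V)
    (c : V -> 'I_k) : Prop :=
  forall e, E e -> ~ monochromatic c e.

Definition colorable (V : Type) (E : hypergraph V) (k : nat) : Prop :=
  exists c : V -> 'I_k, proper_coloring E c.

(* A relation rather than a nat-valued function, so that a hypergraph with no
   proper coloring by finitely many colors gets no chromatic number, instead of
   a default value. *)
Definition is_chromatic_number (V : Type) (E : hypergraph V) (k : nat) : Prop :=
  colorable E k /\ forall m, colorable E m -> k <= m.

(* The set of non-isolated vertices. *)
Definition support (V : Type) (E : hypergraph V) : set V :=
  \bigcup_(e in E) e.

Definition complete_graph (V : Type) (S : set V) : hypergraph V :=
  [set e | e `<=` S /\ e #= `I_2].

(* Equality with K_4 after deletion of isolated vertices, which affect neither
   the family nor its chromatic number: K_4 together with isolated vertices is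
   still a cross-intersecting family of chromatic number 4.  When every vertex
   lies in an edge, support E is the whole of V. *)
Definition is_K4 (V : Type) (E : hypergraph V) : Prop :=
  support E #= `I_4 /\ E = complete_graph (support E).

(* Main.v *)
Require Import Defs.
From mathcomp Require Import all_boot.
From mathcomp Require Import finmap.
From mathcomp Require Import boolp classical_sets cardinality.

Local Open Scope classical_set_scope.

(** Color with the classes P, Q and the rest. If a in A and b in B share two
    vertices u <> v, take P = a \ u and Q = b \ v: every edge meets a or b,
    which P and Q cover, and no edge fits in a proper subset of an n-set. The
    same choice with b = a works when a meets every edge of A. Otherwise every
    a and b meet in exactly one vertex v. If n >= 3, split a `|` b so that
    neither a \ v nor b \ v is monochromatic: an edge of A inside a `|` b
    meets b only once, so it arises from a by exchanging v for a vertex of b,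
    and contains a \ v. If n = 2, every edge has a disjoint edge in its own
    class; the two disjoint pairs form a 4-cycle whose four vertices contain
    all edges, and a missing pair would give a 3-coloring. *)

(** * Cardinality of finite sets *)

Lemma sub_card_eq (T : Type) (n : nat) (e f : set T) :
  (e #= `I_n)%card -> (f #= `I_n)%card -> e `<=` f -> e = f.
Proof.
(* A choice structure on [T] makes [fset] available, where inclusion can be compared with
   cardinality. *)
elim/Pchoice: T => T in e f *.
move=> en fn ef.
have fine : finite_set e by exists n.
have finf : finite_set f by exists n.
apply: fset_set_inj => //; apply/eqP.
rewrite fset_set_sub// in ef.
by rewrite eqEfcard ef (card_fset_set en) (card_fset_set fn) /=.
Qed.

Lemma card_setU1 (T : Type) (n : nat) (x : T) (e : set T) :
  (e #= `I_n)%card -> ~ e x -> ((x |` e) #= `I_n.+1)%card.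
Proof.
by move=> en ex; apply/eq_cardSP; exists x; [left|rewrite setUKD// => _ [-> ]].
Qed.

Lemma card_setD1 (T : Type) (n : nat) (x : T) (e : set T) :
  (e #= `I_n.+1)%card -> e x -> ((e `\ x) #= `I_n)%card.
Proof.
move=> en ex.
have /finite_setP[m em] : finite_set (e `\ x).
  by apply: finite_setD; exists n.+1.
have : ((x |` (e `\ x)) #= `I_m.+1)%card by apply: card_setU1 => // -[_]; exact.
rewrite classical_sets.setD1K// => em'.
have /card_eq_II[->] : (`I_n.+1 #= `I_m.+1)%card by rewrite -(card_eql en).
exact: em.
Qed.

Lemma card_ge2 (T : Type) (n : nat) (e : set T) : (e #= `I_n.+2)%card ->
  exists x y, [/\ e x, e y & x <> y].
Proof.
move=> /eq_cardSP[x ex] /eq_cardSP[y [ey yx] _].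
by exists x, y; split=> // xy; apply: yx.
Qed.

Lemma card_set2 (T : Type) (x y : T) : x <> y -> ([set x; y] #= `I_2)%card.
Proof. by move=> xy; apply: card_setU1 => //; exact: card_set1. Qed.

Lemma card2_eq (T : Type) (e : set T) (x y : T) :
  (e #= `I_2)%card -> e x -> e y -> x <> y -> e = [set x; y].
Proof.
move=> e2 ex ey xy; apply/esym/(sub_card_eq _ 2) => //; first exact: card_set2.
by move=> z [->|->].
Qed.

(** * Criteria for 3-colorability *)

Lemma colorable3 (V : Type) (E : hypergraph V) (P Q : set V) :
  (forall e, E e -> [/\ ~ (e `<=` P), ~ (e `<=` Q) & exists2 x, e x & P x \/ Q x]) ->
  colorable E 3.
Proof.
move=> h.
(* [P] takes precedence over [Q], so the two may overlap: the second color class only shrinks. *)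
pose c x : 'I_3 := if `[< P x >] then inord 0 else
  if `[< Q x >] then inord 1 else inord 2.
have cE x : c x = (if `[< P x >] then 0 else if `[< Q x >] then 1 else 2) :> nat.
  by rewrite /c; case: asboolP => _; [|case: asboolP => _]; rewrite inordK.
exists c => e /h[eP eQ [x ex xPQ]] [i ci].
have iE y : e y -> i = (if `[< P y >] then 0 else if `[< Q y >] then 1 else 2) :> nat.
  by move=> ey; rewrite -(ci _ ey).
case: (posnP i) => i0.
  apply: eP => y /iE; rewrite i0.
  by case: asboolP => // _; case: asboolP.
(* The color is now nonzero, and [x] rules out 2, so all of [e] lies in [Q]. *)
apply: eQ => y /iE; case: asboolP => [_ i0'|_]; first by rewrite i0' in i0.
case: asboolP => // _; rewrite (iE _ ex).
case: asboolP => // nPx; case: asboolP => // nQx.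
by case: xPQ.
Qed.

(** As [u <> v], the vertex removed from either edge survives in the other, so the two classes still
    cover [f] and [g]. The case [f = g] is allowed. *)
Lemma colorable_common_pair (V : Type) (n : nat) (E : hypergraph V)
    (f g : set V) (u v : V) :
  uniform n E -> (f #= `I_n)%card -> (g #= `I_n)%card ->
  f u -> f v -> g u -> g v -> u <> v ->
  (forall e, E e -> exists2 x, e x & f x \/ g x) -> colorable E 3.
Proof.
move=> En fn gn fu fv gu gv uv meet.
apply: (@colorable3 _ _ (f `\ u) (g `\ v)) => e Ee; split.
- move=> ef; have efE : e = f.
    by apply: (sub_card_eq _ _ _ _ (En _ Ee) fn) => x /ef[].
  by have [_ /(_ erefl)] : (f `\ u) u by apply: ef; rewrite efE.
- move=> eg; have egE : e = g.
    by apply: (sub_card_eq _ _ _ _ (En _ Ee) gn) => x /eg[].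
  by have [_ /(_ erefl)] : (g `\ v) v by apply: eg; rewrite egE.
- have [x ex fgx] := meet _ Ee; exists x => //.
  have [->|xu] := pselect (x = u); first by right.
  have [->|xv] := pselect (x = v); first by left; split=> // /esym.
  by case: fgx => ?; [left|right].
Qed.

(** * Consequences of not being 3-colorable *)

Lemma cross_sym (V : Type) (A B : hypergraph V) :
  cross_intersecting_family A B -> cross_intersecting_family B A.
Proof. by case=> A0 B0 AB; split=> // b a Bb Aa; rewrite setIC; exact: AB. Qed.

Lemma cross_inter_uniq (V : Type) (n : nat) (A B : hypergraph V) (a b : set V)
    (u v : V) :
  cross_intersecting_family A B -> uniform n (A `|` B) ->
  ~ colorable (A `|` B) 3 -> A a -> B b ->
  a u -> b u -> a v -> b v -> u = v.
Proof.
move=> [_ _ AB] En nc Aa Bb au bu av bv; apply: contrapT => uv; apply: nc.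
apply: (@colorable_common_pair _ n _ a b u v) => //.
- by apply: En; left.
- by apply: En; right.
- move=> e [Ae|Be].
    by have [x [ex bx]] := AB _ _ Ae Bb; exists x => //; right.
  by have [x [ax ex]] := AB _ _ Aa Be; exists x => //; left.
Qed.

(** Otherwise [a] meets every edge of [A] and of [B], and any two of its vertices form a common pair
    with [f = g = a]. *)
Lemma cross_disjoint (V : Type) (n : nat) (A B : hypergraph V) (a : set V) :
  (2 <= n)%N -> cross_intersecting_family A B -> uniform n (A `|` B) ->
  ~ colorable (A `|` B) 3 -> A a ->
  exists2 a', A a' & forall x, a x -> ~ a' x.
Proof.
case: n => [|[|n]] // _ [_ _ AB] En nc Aa.
apply: contrapT => nex; apply: nc.
have an : (a #= `I_n.+2)%card by apply: En; left.
have [u [v [au av uv]]] := card_ge2 _ _ _ an.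
apply: (@colorable_common_pair _ n.+2 _ a a u v) => //.
move=> e [Ae|Be].
  apply: contrapT => h; apply: nex; exists e => // x ax ex.
  by apply: h; exists x => //; left.
by have [x [ax ex]] := AB _ _ Aa Be; exists x => //; left.
Qed.

(** * Uniformity at least three *)

Lemma exchange_contra (V : Type) (n : nat) (e a b : set V) (v w x : V) :
  (e #= `I_n)%card -> (a #= `I_n)%card -> e `<=` a `|` b ->
  a v -> b v -> (forall y, e y -> b y -> y = w) ->
  a x -> ~ e x -> x <> v -> False.
Proof.
move=> en an eab av bv ew ax ex xv.
(* Trading [w] for [x] is injective on [e], since [x] is not in [e], and maps [e] into [a], since
   only [w] can lie in [b]. By cardinality the image is all of [a]; yet it misses [v], which could
   only come from [w]. *)
pose g y := if `[< y = w >] then x else y.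
have gv : ~ [set g y | y in e] v.
  move=> [y ey]; rewrite /g; case: asboolP => // yw yv.
  by apply: yw; apply: ew => //; rewrite yv.
have : [set g y | y in e] = a.
  apply: (sub_card_eq _ n) => //.
    rewrite (card_eql (inj_card_eq _))// => y z; rewrite !inE => ey ez.
    rewrite /g; do 2!case: asboolP => //; first by move=> -> ->.
      by move=> _ _ xz; case: ex; rewrite xz.
    by move=> _ _ yx; case: ex; rewrite -yx.
  move=> _ [y ey <-]; rewrite /g; case: asboolP => // yw.
  by case: (eab _ ey) => // /(ew _ ey).
by move=> E; apply: gv; rewrite E.
Qed.

Lemma cross_colorable3 (V : Type) (n : nat) (A B : hypergraph V) :
  (3 <= n)%N -> cross_intersecting_family A B -> uniform n (A `|` B) ->
  colorable (A `|` B) 3.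
Proof.
case: n => [|[|[|n]]] // _ cAB En; apply: contrapT => nc.
have uniqAB := cross_inter_uniq V _ A B _ _ _ _ cAB En nc.
have [[a Aa] [b Bb] AB] := cAB.
have an e : A e -> (e #= `I_n.+3)%card by move=> Ae; apply: En; left.
have bn e : B e -> (e #= `I_n.+3)%card by move=> Be; apply: En; right.
have [v [av bv]] := AB _ _ Aa Bb.
(* As [n] is at least 3, [a] and [b] each have two vertices other than [v]. *)
have [x [x' [[ax xv] [ax' xv'] xx']]] :=
  card_ge2 _ _ _ (card_setD1 _ _ _ _ (an _ Aa) av).
have [y [y' [[by_ yv] [by' yv'] yy']]] :=
  card_ge2 _ _ _ (card_setD1 _ _ _ _ (bn _ Bb) bv).
have notsub e p q : (A `|` B) e -> a p -> p <> v -> b q -> q <> v ->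
    ~ (e `<=` (a `|` b) `\` [set p; q]).
  move=> Ee ap pv bq qv sub.
  have ep : ~ e p by move=> /sub[_]; apply; left.
  (* An edge of [A] is refuted by the missing [p], an edge of [B] by the missing [q], with [a] and
     [b] exchanged. *)
  have eq : ~ e q by move=> /sub[_]; apply; right.
  case: Ee => [Ae|Be].
    have [w [ew bw]] := AB _ _ Ae Bb.
    apply: (@exchange_contra _ n.+3 e a b v w p) => //; try exact: an.
      by move=> z /sub[].
    by move=> z ez bz; exact: (uniqAB e b).
  have [w [aw ew]] := AB _ _ Aa Be.
  apply: (@exchange_contra _ n.+3 e b a v w q) => //; try exact: bn.
    by move=> z /sub[[]]; [right|left].
  by move=> z ez az; exact: (uniqAB a e).
(* The classes overlap; the resulting second color is exactly [x] and [y], while [x'] and [y'] get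
   the first. *)
apply: nc; apply: (@colorable3 _ _ ((a `|` b) `\` [set x; y])
                                   ((a `|` b) `\` [set x'; y'])) => e Ee.
split; [exact: notsub|exact: notsub|].
have [w ew abw] : exists2 w, e w & (a `|` b) w.
  case: Ee => [Ae|Be].
    by have [w [ew bw]] := AB _ _ Ae Bb; exists w => //; right.
  by have [w [aw ew]] := AB _ _ Aa Be; exists w => //; left.
exists w => //.
(* The removed pairs are disjoint: [x = y'] or [y = x'] would be a common vertex of [a] and [b],
   hence [v]. *)
have [wxy|wxy] := pselect ([set x; y] w); last by left.
right; split=> // wxy'; case: wxy => wE; case: wxy' => wE'.
- by apply: xx'; rewrite -wE -wE'.
- apply: xv; apply: (uniqAB a b) => //; rewrite -wE wE'; exact: by'.
- apply: yv; apply: (uniqAB a b) => //; rewrite -wE wE'; exact: ax'.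
- by apply: yy'; rewrite -wE -wE'.
Qed.

(** * Graphs on four vertices *)

Lemma missing_pair_colorable (V : Type) (E : hypergraph V) (s t w z : V) :
  uniform 2 E -> (forall e, E e -> e `<=` [set s; t; w; z]) ->
  ~ E [set s; t] -> colorable E 3.
Proof.
(* The non-edge shares a color; [w] and [z] get one each. *)
move=> E2 ES nst; apply: (@colorable3 _ _ [set s; t] [set w]) => e Ee.
have [x [y [ex ey xy]]] := card_ge2 _ _ _ (E2 _ Ee); split.
- move=> est; apply: nst.
  suff eE : e = [set s; t] by rewrite -eE.
  have st : s <> t.
    by move=> st; apply: xy; case: (est _ ex) => ->; case: (est _ ey) => ->.
  exact: (sub_card_eq _ _ _ _ (E2 _ Ee) (card_set2 _ _ _ st)).
- by move=> ew; apply: xy; rewrite (ew _ ex) (ew _ ey).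
- have [xS|xz] := ES _ Ee _ ex.
    by exists x.
  have [yS|yz] := ES _ Ee _ ey.
    by exists y.
  by case: xy; rewrite xz yz.
Qed.

Lemma pairs_K4 (V : Type) (E : hypergraph V) (s t w z : V) :
  uniform 2 E -> (forall e, E e -> e `<=` [set s; t; w; z]) ->
  ~ colorable E 3 ->
  s <> t -> s <> w -> s <> z -> t <> w -> t <> z -> w <> z -> is_K4 E.
Proof.
move=> E2 ES nc st sw sz tw tz wz.
(* The criterion concerns the first two vertices listed; reordering the list reaches all six
   pairs. *)
have Epair p q r r' : [set s; t; w; z] = [set p; q; r; r'] -> E [set p; q].
  move=> eqS; apply: contrapT => npq; apply: nc.
  by apply: (missing_pair_colorable _ _ p q r r') => //; rewrite -eqS.
have perm4 p q r r' : [set p; q; r; r'] `<=` [set s; t; w; z] ->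
    [set s; t; w; z] `<=` [set p; q; r; r'] -> E [set p; q].
  by move=> ? ?; apply: (Epair p q r r'); rewrite eqEsubset.
have Est : E [set s; t] by apply: (Epair s t w z).
have Esw : E [set s; w].
  by apply: (perm4 s w t z) => x; rewrite /setU /=; tauto.
have Esz : E [set s; z].
  by apply: (perm4 s z t w) => x; rewrite /setU /=; tauto.
have Etw : E [set t; w].
  by apply: (perm4 t w s z) => x; rewrite /setU /=; tauto.
have Etz : E [set t; z].
  by apply: (perm4 t z s w) => x; rewrite /setU /=; tauto.
have Ewz : E [set w; z].
  by apply: (perm4 w z s t) => x; rewrite /setU /=; tauto.
have suppE : Defs.support E = [set s; t; w; z].
  apply/seteqP; split=> [x [e Ee]|x]; first exact: ES.
  move=> [[[->|->]|->]|->]; [exists [set s; t]|exists [set s; t]|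
    exists [set w; z]|exists [set w; z]] => //; by [left|right].
rewrite /is_K4 suppE; split.
  rewrite setUC; apply: card_setU1; last by move=> [[/esym|/esym]|/esym].
  rewrite setUC; apply: card_setU1; last by move=> [/esym|/esym].
  exact: card_set2.
apply/seteqP; split=> [e Ee|e [eS e2]]; first by split; [exact: ES|exact: E2].
have [x [y [ex ey xy]]] := card_ge2 _ _ _ e2.
rewrite (card2_eq _ _ _ _ e2 ex ey xy).
case: (eS _ ex) (eS _ ey) => [[[]|]|] xE [[[]|]|] yE;
  rewrite /= in xE yE; subst; by [|rewrite setUC].
Qed.

Lemma colorable_chromatic_number (V : Type) (E : hypergraph V) (m : nat) :
  colorable E m -> exists k, is_chromatic_number E k /\ (k <= m)%N.
Proof.
move=> cm.
have ex : exists k, (fun k => `[< colorable E k >]) k by exists m; apply/asboolP.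
case: (ex_minnP ex) => k /asboolP ck kmin.
by exists k; split; [split=> // l cl|]; apply: kmin; apply/asboolP.
Qed.

Theorem corollary1p6 (V : Type) (n : nat) (A B : hypergraph V)
    (n_ge2 : 2 <= n)
    (crossAB : cross_intersecting_family A B)
    (uniformAB : uniform n (A `|` B)) :
  (exists k, is_chromatic_number (A `|` B) k /\ k <= 3) \/
  (n = 2 /\ is_K4 (A `|` B)).
Proof.
have [c3|nc] := pselect (colorable (A `|` B) 3).
  by left; exact: colorable_chromatic_number.
right.
have n2 : n = 2.
  apply/eqP; rewrite eqn_leq n_ge2 andbT leqNgt; apply/negP => n3.
  exact: (nc (cross_colorable3 _ _ _ _ n3 crossAB uniformAB)).
split=> //; subst n.
have [[a Aa] [b Bb] AB] := crossAB.
have [a' Aa' aa'] := cross_disjoint _ _ _ _ _ n_ge2 crossAB uniformAB nc Aa.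
have [b' Bb' bb'] : exists2 b', B b' & forall x, b x -> ~ b' x.
  by apply: (@cross_disjoint _ 2 B A) => //; [exact: cross_sym|rewrite setUC..].
(* These are the corners of the 4-cycle; any two are separated by the disjoint edges [a], [a'] or by
   [b], [b']. *)
have [s [as_ bs]] := AB _ _ Aa Bb.
have [t [at_ b't]] := AB _ _ Aa Bb'.
have [w [a'w bw]] := AB _ _ Aa' Bb.
have [z [a'z b'z]] := AB _ _ Aa' Bb'.
have neqa p q : a p -> a' q -> p <> q by move=> ap a'q pq; apply: (aa' p); rewrite // pq.
have neqb p q : b p -> b' q -> p <> q by move=> bp b'q pq; apply: (bb' p); rewrite // pq.
have A2 e : A e -> (e #= `I_2)%card by move=> Ae; apply: uniformAB; left.
have B2 e : B e -> (e #= `I_2)%card by move=> Be; apply: uniformAB; right.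
have aE : a = [set s; t] by apply: card2_eq (A2 _ Aa) as_ at_ (neqb _ _ bs b't).
have a'E : a' = [set w; z] by apply: card2_eq (A2 _ Aa') a'w a'z (neqb _ _ bw b'z).
have bE : b = [set s; w] by apply: card2_eq (B2 _ Bb) bs bw (neqa _ _ as_ a'w).
have b'E : b' = [set t; z] by apply: card2_eq (B2 _ Bb') b't b'z (neqa _ _ at_ a'z).
apply: (@pairs_K4 _ _ s t w z) => //; try by [exact: neqa|exact: neqb].
  (* An edge of [A] meets the disjoint [b] and [b'], so it has one vertex in each; dually for
     [B]. *)
  move=> e [Ae|Be].
    have [p [ep bp]] := AB _ _ Ae Bb.
    have [q [eq b'q]] := AB _ _ Ae Bb'.
    rewrite (card2_eq _ _ _ _ (A2 _ Ae) ep eq (neqb _ _ bp b'q)).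
    move: bp b'q; rewrite bE b'E => -[] -> [] -> x; rewrite /setU /=; tauto.
  have [p [ap ep]] := AB _ _ Aa Be.
  have [q [a'q eq]] := AB _ _ Aa' Be.
  rewrite (card2_eq _ _ _ _ (B2 _ Be) ep eq (neqa _ _ ap a'q)).
  move: ap a'q; rewrite aE a'E => -[] -> [] -> x; rewrite /setU /=; tauto.
Qed.
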